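(* Let $\mathcal H$ be a finite-dimensional real Hilbert space, $\mathcal A:\mathcal H\to 2^{\mathcal H}$ a maximally monotone operator, $h:\mathcal H\to\,]-\infty,+\infty]$ a proper, lower semi-continuous, convex function, and $\mathcal Q:\mathcal H\to\mathcal H$ a symmetric positive definite linear operator. Then the identity operator $\mathcal I$ on $\mathcal H$ can be decomposed as follows. (i) $$\mathcal I=\mathcal J_{\mathcal Q^{-1}\mathcal A}+\mathcal J_{\mathcal A^{-1}\mathcal Q}=\mathcal J_{\mathcal Q^{-1}\mathcal A}+\mathcal Q^{-1}\circ\mathcal J_{\mathcal Q\circ\mathcal A^{-1}}\circ\mathcal Q=\mathcal Q^{-1}\circ\mathcal J_{\mathcal A\circ\mathcal Q^{-1}}\circ\mathcal Q+\mathcal J_{\mathcal A^{-1}\mathcal Q}.$$ (ii) $$\mathcal I=\mathcal Q^{-\frac12}\circ\operatorname{prox}_{h\circ\mathcal Q^{-\frac12}}\circ\,\mathcal Q^{\frac12}+\mathcal Q^{-\frac12}\circ\operatorname{prox}_{h^*\circ\mathcal Q^{\frac12}}\circ\,\mathcal Q^{\frac12}=\operatorname{prox}_h^{\mathcal Q}+\mathcal Q^{-1}\circ\operatorname{prox}_{h^*}^{\mathcal Q^{-1}}\circ\,\mathcal Q.$$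
   Context: For a set-valued operator $\mathcal B$, $\mathcal J_{\mathcal B}:=(\mathcal I+\mathcal B)^{-1}$; $\mathcal A^{-1}$ is the set-valued inverse. $h^*$ is the Fenchel conjugate. For a symmetric positive definite $\mathcal P$, $\|x\|_{\mathcal P}^2:=\langle\mathcal Px|x\rangle$ and, for a proper lower semi-continuous convex $g$, $\operatorname{prox}_g^{\mathcal P}(b):=\arg\min_x\, g(x)+\frac12\|x-b\|_{\mathcal P}^2$; $\operatorname{prox}_g:=\operatorname{prox}_g^{\mathcal I}$. *)

(* Defs.v *)
From HB Require Import structures.
From mathcomp Require Import all_boot all_order all_algebra.
From mathcomp Require Import sesquilinear.
From mathcomp Require Import all_classical all_reals constructive_ereal ereal.

Set Implicit Arguments.
Unset Strict Implicit.
Unset Printing Implicit Defensive.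

Import Order.TTheory GRing.Theory Num.Theory.
Local Open Scope classical_set_scope.
Local Open Scope ring_scope.

Section SetValuedOperators.
Context {R : realType} {H : vectType R}.
Implicit Types (f : H -> H) (A B : H -> set H).

Definition sv f : H -> set H := fun x => [set f x].

Definition sv_add A B : H -> set H :=
  fun x => [set u + v | u in A x & v in B x].

Definition sv_comp B A : H -> set H := fun x => \bigcup_(y in A x) B y.

Definition sv_inv A : H -> set H := fun u => [set x | A x u].

Definition resolvent B : H -> set H := sv_inv (sv_add (sv idfun) B).

End SetValuedOperators.

Notation "B [o] A" := (sv_comp B A) (at level 40, left associativity).
Notation "A [+] B" := (sv_add A B) (at level 50, left associativity).

(* A finite-dimensional real Hilbert space is a [vectType] over a [realType]
   carrying a positive definite symmetric bilinear form; completeness is then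
   automatic. *)
Section Hilbert.
Context {R : realType} {H : vectType R}.
Variable dot : {dot H for (@idfun R)}.
Implicit Types (A B : H -> set H) (P Q S : 'End(H)) (g h : H -> \bar R).

Definition hnorm (x : H) : R := Num.sqrt (dot x x).

Definition monotone_op A : Prop :=
  forall x y u v, A x u -> A y v -> 0 <= dot (u - v) (x - y).

Definition maximally_monotone A : Prop :=
  monotone_op A /\
  forall B, monotone_op B -> (forall x, A x `<=` B x) -> B = A.

Definition selfadjoint P : Prop := forall x y, dot (P x) y = dot x (P y).

Definition sym_posdef P : Prop :=
  selfadjoint P /\ forall x, x != 0 -> 0 < dot (P x) x.

(* The symmetric positive definite square root; the default value [\1] is
   irrelevant when [Q] is symmetric positive definite. *)
Definition sqrt_op Q : 'End(H) :=
  xget \1%VF [set S | sym_posdef S /\ (S \o S)%VF = Q].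

Definition sqnorm P (x : H) : R := dot (P x) x.

Local Open Scope ereal_scope.

Definition proper_fun h : Prop :=
  (forall x, -oo < h x) /\ exists x, h x < +oo.

(* [lower_semicontinuous] for the topology of [hnorm]. *)
Definition lsc_fun h : Prop :=
  forall x (a : R), a%:E < h x ->
    exists2 e : R, (0 < e)%R & forall y, (hnorm (y - x) < e)%R -> a%:E < h y.

Definition convex_fun h : Prop :=
  forall x y (t : R), (0 <= t <= 1)%R ->
    h (t *: x + (1 - t) *: y)%R <= t%:E * h x + (1 - t)%:E * h y.

Definition conjugate h : H -> \bar R :=
  fun u => ereal_sup [set (dot x u)%:E - h x | x in [set: H]].

(* The argmin is kept as the set of all minimizers. *)
Definition prox P g : H -> set H :=
  fun b => [set x | forall y,
    g x + (2^-1 * sqnorm P (x - b))%:E <= g y + (2^-1 * sqnorm P (y - b))%:E].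

End Hilbert.

(* Main.v *)
(** For (i), everything follows from Minty's theorem in the form: for every [x]
there is a (unique) [y] with [Q (x - y)] in [A y]; the four operators of (i) are
then the points [y] and [x - y].  Minty's theorem is obtained by minimizing the
sum of the Fitzpatrick function of [A] and a quadratic on [H * H].  For (ii), let
[p] minimize [h + |. - b|_Q^2 / 2]; then [u := Q (b - p)] is a subgradient of [h]
at [p], hence [p] is a subgradient of the conjugate at [u], and each of the four
proximal points is read off such a pair.  Both minimizations are the proximal
problem of a proper lower semicontinuous convex function, solved by a minimizing
sequence, which is Cauchy by the parallelogram identity. *)

Require Import Defs.
From HB Require Import structures.
From mathcomp Require Import all_boot all_order all_algebra.
From mathcomp Require Import sesquilinear.
From mathcomp Require Import all_classical all_reals constructive_ereal ereal.
From mathcomp Require Import topology normedtype sequences.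
From mathcomp Require Import complex.
From mathcomp Require Import ring lra.

Set Implicit Arguments.
Unset Strict Implicit.
Unset Printing Implicit Defensive.

Import Order.TTheory GRing.Theory Num.Theory.
Import numFieldNormedType.Exports.
Local Open Scope classical_set_scope.
Local Open Scope ring_scope.

(** * Inner products on finite-dimensional spaces *)

(** A predicate on a bare function, so that [dot], the form of a positive definite operator and a
    form on [H * H] are all instances. *)
Definition inner_product (R : realType) (V : vectType R) (d : V -> V -> R) :=
  [/\ forall x y, d x y = d y x,
      forall a x y z, d (a *: x + y) z = a * d x z + d y z
    & forall x, x != 0 -> 0 < d x x].

Lemma real_cauchy_cvg (R : realType) (u : nat -> R) :
  (forall e : R, 0 < e ->
     exists n0, forall n m, (n0 <= n)%N -> (n0 <= m)%N -> `|u n - u m| < e) ->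
  exists l : R, u @ \oo --> l.
Proof.
move=> u_cauchy; exists (lim (u @ \oo)); apply/cauchy_cvgP/cauchy_exP => e e0.
have [n0 Hn0] := u_cauchy e e0; exists (u n0); exists n0 => // n /= n0n.
exact: Hn0.
Qed.

Section InnerProduct.
Context (R : realType) (V : vectType R) (d : V -> V -> R).
Hypothesis ip : inner_product d.

Lemma ipC x y : d x y = d y x. Proof. by case: ip. Qed.

Lemma ipDl x y z : d (x + y) z = d x z + d y z.
Proof. by case: ip => _ dl _; rewrite -{1}(scale1r x) dl mul1r. Qed.

Lemma ip0l z : d 0 z = 0.
Proof. by apply: (addrI (d 0 z)); rewrite -ipDl !addr0. Qed.

Lemma ipZl a x z : d (a *: x) z = a * d x z.
Proof. by case: ip => _ dl _; rewrite -[a *: x]addr0 dl ip0l addr0. Qed.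

Lemma ipNl x z : d (- x) z = - d x z.
Proof. by rewrite -scaleN1r ipZl mulN1r. Qed.

Lemma ipDr x y z : d z (x + y) = d z x + d z y.
Proof. by rewrite ipC ipDl !(ipC z). Qed.

Lemma ip0r z : d z 0 = 0. Proof. by rewrite ipC ip0l. Qed.

Lemma ipZr a x z : d z (a *: x) = a * d z x.
Proof. by rewrite ipC ipZl ipC. Qed.

Lemma ipNr x z : d z (- x) = - d z x.
Proof. by rewrite ipC ipNl ipC. Qed.

Definition ipE := (ipDl, ipDr, ipNl, ipNr, ipZl, ipZr, ip0l, ip0r).

Lemma ip_ge0 x : 0 <= d x x.
Proof.
by have [->|x0] := eqVneq x 0; rewrite ?ip0l // ltW //; case: ip => _ _; apply.
Qed.

Lemma ip_le0_eq0 x : d x x <= 0 -> x = 0.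
Proof.
by move=> x0; apply/eqP/negPn/negP; case: ip => _ _ /[apply]; rewrite ltNge x0.
Qed.

Lemma ip_cauchy_schwarz x y : d x y ^+ 2 <= d x x * d y y.
Proof.
have [->|y0] := eqVneq y 0; first by rewrite !ipE expr0n mulr0.
have yy : 0 < d y y by case: ip => _ _; apply.
have := ip_ge0 (d y y *: x - d x y *: y); rewrite !ipE (ipC y x) => h.
have : 0 <= d y y * (d x x * d y y - d x y ^+ 2) by lra.
by rewrite pmulr_rge0 // subr_ge0.
Qed.

(** Pairing with a basis is an injective map to row vectors of the same dimension, hence onto; [r]
    is a preimage of the row of values of [L] on the basis. *)
Lemma riesz (L : V -> R) :
  (forall a x y, L (a *: x + y) = a * L x + L y) -> exists r, forall x, L x = d r x.
Proof.
move=> Llin; pose e := vbasis (@fullv R V).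
pose phi (x : V) : 'rV[R]_(\dim (@fullv R V)) := \row_i d x e`_i.
have phi_lin : linear phi by move=> a x y; apply/rowP => i; rewrite !mxE !ipE.
pose philin := GRing.isLinear.Build _ _ _ _ phi phi_lin.
pose phiL : {linear V -> 'rV[R]_(\dim (@fullv R V))} := HB.pack phi philin.
pose f := linfun phiL.
have L0 : L 0 = 0.
  by have := Llin (-1) 0 0; rewrite scaler0 addr0 mulN1r addNr.
have fE x i : f x 0 i = d x e`_i by rewrite lfunE mxE.
have Lsum (I : Type) (s : seq I) (c : I -> R) (v : I -> V) :
    L (\sum_(i <- s) c i *: v i) = \sum_(i <- s) c i * L (v i).
  by elim: s => [|i s IH]; rewrite ?big_nil // !big_cons Llin IH.
have dsum y (I : Type) (s : seq I) (c : I -> R) (v : I -> V) :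
    d y (\sum_(i <- s) c i *: v i) = \sum_(i <- s) c i * d y (v i).
  by elim: s => [|i s IH]; rewrite ?big_nil ?ip0r // !big_cons !ipE IH.
have eE x : x = \sum_i coord e i x *: e`_i by apply: coord_vbasis; exact: memvf.
have ker0 : lker f == 0%VS.
  apply/lker0P => x y fxy; apply/eqP; rewrite -subr_eq0; apply/eqP/ip_le0_eq0.
  rewrite {2}(eE (x - y)) dsum big1 // => i _.
  by rewrite ipDl ipNl -!fE fxy subrr mulr0.
have [r fr] : exists r, f r = \row_i L e`_i.
  have full : limg f = fullv.
    apply/eqP; rewrite eqEdim subvf /=.
    rewrite limg_dim_eq ?(eqP ker0) ?capv0 // dimvf /dim /= mul1n leqnn //.
  by have /memv_imgP[r _ ->] : \row_i L e`_i \in limg f; [rewrite full memvf|exists r].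
exists r => x; rewrite (eE x) Lsum dsum; apply: eq_bigr => i _.
by rewrite -fE fr mxE.
Qed.

(* A Cauchy sequence converges weakly by Riesz, and the Cauchy property turns
   weak convergence into strong convergence. *)
Lemma ip_complete (x : nat -> V) :
  (forall e : R, 0 < e -> exists n0, forall n m, (n0 <= n)%N -> (n0 <= m)%N ->
     d (x n - x m) (x n - x m) < e) ->
  exists p, forall e : R, 0 < e -> exists n0, forall n, (n0 <= n)%N ->
     d (x n - p) (x n - p) < e.
Proof.
move=> x_cauchy.
have weak y : exists l : R, (fun n => d (x n) y) @ \oo --> l.
  apply: real_cauchy_cvg => e e0.
  have Ny := ip_ge0 y.
  have [|n0 Hn0] := x_cauchy (e ^+ 2 / (d y y + 1)).
    by rewrite divr_gt0 ?exprn_gt0 //; lra.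
  exists n0 => n m n0n n0m; rewrite -ipNl -ipDl.
  rewrite -(@ltr_pXn2r _ 2%N) ?nnegrE ?normr_ge0 ?ltW //= real_normK ?num_real //.
  apply: le_lt_trans (ip_cauchy_schwarz _ _) _.
  have := Hn0 _ _ n0n n0m; rewrite ltr_pdivlMr; last by lra.
  have := ip_ge0 (x n - x m); nra.
pose L y := xget 0 [set l : R | (fun n => d (x n) y) @ \oo --> l].
have LP y : (fun n => d (x n) y) @ \oo --> L y.
  by have [l Hl] := weak y; apply: (@xgetPex _ 0 [set l : R | _ @ \oo --> l]); exists l.
have [|p Lp] := @riesz L.
  move=> a y z; apply: (@cvg_unique _ (@norm_hausdorff R R) _ _ _ _ (LP _)).
  have -> : (fun n => d (x n) (a *: y + z)) = (fun n => a * d (x n) y + d (x n) z).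
    by apply/funext => n; rewrite !ipE.
  apply: cvgD; last exact: LP.
  by apply: cvgM; [exact: cvg_cst|exact: LP].
exists p => e e0.
have e4 : 0 < e / 4 by lra.
have [n0 Hn0] := x_cauchy _ e4; exists n0 => n n0n.
have /cvgrPdist_lt /(_ _ e4) [m0 _ Hm0] := LP (x n - p).
pose m := maxn n0 m0.
have := Hm0 m (leq_maxr _ _); rewrite /= Lp.
have := Hn0 _ m n0n (leq_maxl _ _).
(* With [a] and [b] as below, |a + b|^2 = |a|^2 + 2 <b, a + b> - |b|^2: the Cauchy property bounds
   the first term, weak convergence tested against [x n - p] the second. *)
have -> : x n - p = (x n - x m) + (x m - p) by rewrite addrA subrK.
set a := x n - x m; set b := x m - p.
have -> : d p (a + b) - d (x m) (a + b) = - d b (a + b) by rewrite /b !ipE; lra.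
rewrite normrN ltr_norml; clearbody a b => Na /andP[_ Hb].
have := ip_ge0 b.
move: Hb Na; rewrite !ipE (ipC b a); lra.
Qed.

End InnerProduct.

(** In the expansion of [d1 x x] along a basis, both factors of each product are Riesz functionals
    for [d2], so Cauchy-Schwarz bounds it. *)
Lemma ip_equiv (R : realType) (V : vectType R) (d1 d2 : V -> V -> R) :
  inner_product d1 -> inner_product d2 ->
  exists2 C, 0 < C & forall x, d1 x x <= C * d2 x x.
Proof.
move=> ip1 ip2; pose e := vbasis (@fullv R V).
have rex i : exists r, forall x, coord e i x = d2 r x.
  by apply: riesz => // a x y; rewrite linearP.
have sex (i : 'I_(\dim (@fullv R V))) : exists s, forall x, d1 e`_i x = d2 s x.
  by apply: riesz => // a x y; rewrite !(ipE ip1).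
have [r rP] := choice rex; have [s sP] := choice sex.
(* The summand 1 keeps the constant positive even in dimension zero. *)
exists (1 + \sum_i (d2 (r i) (r i) + d2 (s i) (s i)) / 2).
  rewrite ltr_pwDl // sumr_ge0 // => i _.
  by rewrite divr_ge0 // addr_ge0 // ip_ge0.
move=> x; have eE : x = \sum_i coord e i x *: e`_i by apply: coord_vbasis; exact: memvf.
have -> : d1 x x = \sum_i coord e i x * d1 e`_i x.
  rewrite {1}eE; move: (index_enum _) => I.
  by elim: I => [|i I IH]; rewrite ?big_nil ?(ipE ip1) // !big_cons !(ipE ip1) IH.
rewrite mulrDl mul1r mulr_suml ler_wpDl ?ip_ge0 // ler_sum // => i _.
rewrite rP sP.
have := ip_cauchy_schwarz ip2 (r i) x; have := ip_cauchy_schwarz ip2 (s i) x.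
have := sqr_ge0 (d2 (r i) x - d2 (s i) x); lra.
Qed.

(** * Proximal points of convex functions *)

Definition ip_lsc (R : realType) (V : vectType R) (d : V -> V -> R)
    (g : V -> \bar R) :=
  forall x (a : R), (a%:E < g x)%E ->
    exists2 e : R, 0 < e & forall y, d (y - x) (y - x) < e -> (a%:E < g y)%E.

Section ProxExistence.
Context (R : realType) (V : vectType R) (d : V -> V -> R) (g : V -> \bar R).
Hypotheses (ip : inner_product d) (g_proper : proper_fun g)
  (g_lsc : ip_lsc d g) (g_convex : convex_fun g).

Local Notation dom := [set x | (g x < +oo)%E].
Local Notation f x := (fine (g x)).

Lemma proper_fineK x : dom x -> g x = (f x)%:E.
Proof.
by case: g_proper => gNy _ gxy; rewrite fineK // fin_numElt gNy.
Qed.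

Lemma convex_fine x y t : dom x -> dom y -> 0 <= t <= 1 ->
  dom (t *: x + (1 - t) *: y) /\
  f (t *: x + (1 - t) *: y) <= t * f x + (1 - t) * f y.
Proof.
move=> Dx Dy t01; have := g_convex x y t01.
rewrite (proper_fineK Dx) (proper_fineK Dy) -!EFinM -EFinD => gz.
have Dz : dom (t *: x + (1 - t) *: y) by apply: le_lt_trans gz _; rewrite ltry.
by split; [exact: Dz|rewrite -lee_fin -(proper_fineK Dz)].
Qed.

(* Lower semicontinuity at a point of the domain bounds [g] below on a ball;
   convexity propagates the bound with at most linear growth, which the
   quadratic term absorbs. *)
Lemma prox_objective_bounded b :
  exists m : R, forall y, dom y -> m <= f y + 2^-1 * d (y - b) (y - b).
Proof.
have [gNy [x0 Dx0]] := g_proper.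
have [|e e0 He] := @g_lsc x0 (f x0 - 1).
  by rewrite (proper_fineK Dx0) lte_fin; lra.
(* This choice makes [c ^+ 2 < e]: with [t := c / (1 + s)], the point [t *: y + (1 - t) *: x0] is at
   distance [t * s <= c] from [x0], inside the ball where [g] exceeds [f x0 - 1]. *)
pose c := Num.min 1 e / 2.
have c0 : 0 < c by rewrite divr_gt0 // lt_min ltr01.
have c1 : c <= 2^-1 by rewrite ler_pdivrMr // mulVf // ge_min lexx.
have ce : c <= e / 2 by rewrite ler_pM2r // ge_min lexx orbT.
(* The square of [2^-1 * s - c^-1] absorbs the linear loss [c^-1 * s] into a quarter of [s ^+ 2];
   the last term comes from [s ^+ 2] being at most 2 |y - b|^2 + 2 |x0 - b|^2. *)
exists (f x0 - c^-1 - (c^-1) ^+ 2 - 2^-1 * d (x0 - b) (x0 - b)) => y Dy.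
set s := Num.sqrt (d (y - x0) (y - x0)).
have s0 : 0 <= s by apply: sqrtr_ge0.
have s2 : s ^+ 2 = d (y - x0) (y - x0) by rewrite sqr_sqrtr // ip_ge0.
pose t := c / (1 + s).
have t0 : 0 < t by rewrite divr_gt0 //; lra.
have tc : t <= c by rewrite ler_pdivrMr; [nra|lra].
have tsc : t * s <= c.
  by rewrite /t mulrAC ler_pdivrMr; [nra|lra].
have [|Dz fz] := @convex_fine y x0 t Dy Dx0; first by apply/andP; split; lra.
have gz : f x0 - 1 < f (t *: y + (1 - t) *: x0).
  rewrite -lte_fin -proper_fineK //; apply: He.
  have -> : t *: y + (1 - t) *: x0 - x0 = t *: (y - x0).
    by rewrite scalerBl scale1r scalerBr -addrA [x0 - _ - _]addrAC subrr add0r.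
  rewrite (ipZl ip) (ipZr ip) -s2.
  have ts0 : 0 <= t * s by rewrite mulr_ge0 // ltW.
  by nra.
have ti : t^-1 = c^-1 * (1 + s) by rewrite /t invf_div mulrC.
have H1 : f x0 - t^-1 <= f y.
  have : - 1 <= t * (f y - f x0) by lra.
  rewrite -(ler_pM2l (_ : 0 < t^-1)) ?invr_gt0 // mulrA mulVf ?gt_eqF //; lra.
have H2 : s ^+ 2 <= 2 * d (y - b) (y - b) + 2 * d (x0 - b) (x0 - b).
  have := ip_ge0 ip ((y - b) + (x0 - b)); rewrite s2.
  have -> : y - x0 = (y - b) - (x0 - b) by rewrite opprB addrA subrK.
  move: (y - b) (x0 - b) => u v; rewrite !(ipE ip); lra.
have := sqr_ge0 (2^-1 * s - c^-1).
rewrite ti in H1; lra.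
Qed.

(** Minimality of [p] is recorded as its first-order condition: [b - p] is a subgradient of [g] at
    [p] for the form [d]. *)
Lemma prox_exists b : exists p, dom p /\
  forall y, (g p + (d (b - p) (y - p))%:E <= g y)%E.
Proof.
pose G y := f y + 2^-1 * d (y - b) (y - b).
have [m0 Hm0] := prox_objective_bounded b.
have [gNy [x0 Dx0]] := g_proper.
pose S := [set G y | y in dom].
have S_inf : has_inf S.
  by split; [exists (G x0), x0|exists m0 => _ [y Dy <-]; exact: Hm0].
pose m := inf S.
have mG y : dom y -> m <= G y by move=> Dy; apply: (ge_inf S_inf.2); exists y.
have xex (n : nat) : exists y, dom y /\ G y < m + n.+1%:R^-1.
  have [|_ [y Dy <-] Gy] := @inf_adherent _ _ (n.+1%:R^-1 : R) _ S_inf.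
    by rewrite invr_gt0.
  by exists y.
have [x xP] := choice xex.
have inv_le (n0 n : nat) : (n0 <= n)%N -> (n.+1%:R^-1 : R) <= n0.+1%:R^-1.
  by move=> n0n; rewrite lef_pV2 ?posrE // ler_nat ltnS.
have archi (e : R) : 0 < e -> exists n0 : nat, n0.+1%:R^-1 < e.
  move=> e0; have ei0 : 0 <= e^-1 by rewrite invr_ge0 ltW.
  have H := archi_boundP ei0; exists (Num.Def.archi_bound e^-1).
  rewrite invf_plt ?posrE //; apply: lt_trans H _; rewrite ltr_nat //.
have [|p xp] := @ip_complete _ _ d ip x.
  (* The parallelogram identity at the midpoint gives |x n - x k|^2 < 4 (1/(n+1) + 1/(k+1)), whence
     [e / 8]. *)
  move=> e e0; have [|n0 Hn0] := archi (e / 8); first lra.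
  exists n0 => n k /inv_le n0n /inv_le n0k.
  have [Dn Gn] := xP n; have [Dk Gk] := xP k.
  have [|Dz fz] := @convex_fine (x n) (x k) 2^-1 Dn Dk; first by apply/andP; split; lra.
  have := mG _ Dz; rewrite /G in Gn Gk *.
  have -> : 2^-1 *: x n + (1 - 2^-1) *: x k - b
            = 2^-1 *: ((x n - b) + (x k - b)).
    have -> : (1 - 2^-1 : R) = 2^-1 by lra.
    have bE : b = 2^-1 *: (b + b).
      by rewrite -mulr2n -[b *+ 2]scaler_nat scalerA mulVf // scale1r.
    by rewrite {1}bE -scalerDr -scalerBr addrACA opprD.
  have -> : x n - x k = (x n - b) - (x k - b) by rewrite opprB addrA subrK.
  move: Gn Gk fz; move: (x n - b) (x k - b) => u v; rewrite !(ipE ip) (ipC ip v u).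
  move: n0n n0k Hn0.
  move: (n.+1%:R^-1 : R) (k.+1%:R^-1 : R) (n0.+1%:R^-1 : R) => i j l; lra.
have p_min : (g p + (2^-1 * d (p - b) (p - b))%:E <= m%:E)%E.
  rewrite leNgt; apply/negP => mp.
  (* Lower semicontinuity puts [f (x n)] above [a], so the objective at [x n] would exceed [m] by
     the gap [del] up to the cross term [d (x n - p) (p - b)]; [e'] keeps that term below [del / 2]
     in absolute value, and [n3] keeps the excess over [m] below [del / 2]. *)
  have [a a1 a2] : exists2 a : R, m - 2^-1 * d (p - b) (p - b) < a & (a%:E < g p)%E.
    move: (gNy p) mp; case: (g p) => [r _|_ _|//].
      rewrite -EFinD lte_fin => mr.
      exists (2^-1 * (m - 2^-1 * d (p - b) (p - b) + r)); rewrite ?lte_fin; lra.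
    by exists (m - 2^-1 * d (p - b) (p - b) + 1); rewrite ?ltry //; lra.
  have [e e0 He] := g_lsc a2.
  pose del := a + 2^-1 * d (p - b) (p - b) - m.
  have del0 : 0 < del by rewrite /del; lra.
  pose e' := del ^+ 2 / (4 * (d (p - b) (p - b) + 1)).
  have e'0 : 0 < e' by rewrite divr_gt0 ?exprn_gt0 //; have := ip_ge0 ip (p - b); lra.
  have [n1 Hn1] := xp _ e0; have [n2 Hn2] := xp _ e'0.
  have [|n3 Hn3] := archi (del / 2); first lra.
  pose n := maxn n1 (maxn n2 n3).
  have [Dn Gn] := xP n.
  have /Hn1/He : (n1 <= n)%N by rewrite leq_maxl.
  rewrite (proper_fineK Dn) lte_fin => an.
  have /Hn2 : (n2 <= n)%N by rewrite !leq_max leqnn orbT.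
  rewrite ltr_pdivlMr; last by have := ip_ge0 ip (p - b); lra.
  have /inv_le n3n : (n3 <= n)%N by rewrite !leq_max leqnn !orbT.
  rewrite /G in Gn.
  have xnb : x n - b = (x n - p) + (p - b) by rewrite addrA subrK.
  rewrite xnb in Gn.
  have := ip_cauchy_schwarz ip (x n - p) (p - b).
  have := ip_ge0 ip (x n - p).
  have delE : a = del - 2^-1 * d (p - b) (p - b) + m by rewrite /del; lra.
  move: Gn an delE Hn3 n3n del0; clear e'0 Hn2; clearbody del.
  move: (n.+1%:R^-1 : R) (n3.+1%:R^-1 : R) (x n - p) (p - b) => i j u v.
  rewrite !(ipE ip) (ipC ip v u) => Gn an delE Hn3 n3n del0 Nu CS Nlt.
  have K : d u v < - (del / 2) by lra.
  have : (del / 2) ^+ 2 < d u v ^+ 2 by nra.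
  lra.
have Dp : dom p.
  move: p_min; rewrite /=; case: (g p) => [r|//|//] _; exact: ltry.
exists p; split=> // y.
have [gy|] := ltP (g y) +oo%E; last first.
  by rewrite leye_eq => /eqP ->; rewrite leey.
rewrite (proper_fineK Dp) (proper_fineK gy) -EFinD lee_fin.
move: p_min; rewrite (proper_fineK Dp) -EFinD lee_fin => p_min.
(* Compare [p] with the point a fraction [t] of the way to [y] and divide by [t]; the choice of [t]
   keeps the leftover quadratic term below [e]. *)
apply/ler_addgt0Pr => e e0.
have Nyp := ip_ge0 ip (y - p).
pose t := Num.min 1 (e / (d (y - p) (y - p) + 1)).
have t0 : 0 < t by rewrite lt_min ltr01 divr_gt0 //; lra.
have t1 : t <= 1 by rewrite ge_min lexx.
have te : t * d (y - p) (y - p) <= e.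
  have : t <= e / (d (y - p) (y - p) + 1) by rewrite ge_min lexx orbT.
  rewrite ler_pdivlMr; [nra|lra].
have [|Dz fz] := @convex_fine y p t gy Dp; first by apply/andP; split; lra.
have := mG _ Dz; rewrite /G.
have -> : t *: y + (1 - t) *: p - b = t *: (y - p) + (p - b).
  by rewrite scalerBl scale1r scalerBr !addrA; congr (_ - _); rewrite addrAC.
have -> : b - p = - (p - b) by rewrite opprB.
move: p_min te Nyp; move: (y - p) (p - b) => u v.
rewrite !(ipE ip) (ipC ip v u) => p_min te Nu Gz.
have : 0 <= t * (f y - f p + d u v + 2^-1 * t * d u u) by lra.
rewrite pmulr_rge0 //; lra.
Qed.

End ProxExistence.

(** * Minty's theorem *)

Section SupAffine.
Context (R : realType) (V : vectType R) (d : V -> V -> R).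
Context (I : Type) (D : set I) (r : I -> V) (c : I -> R).
Hypothesis ip : inner_product d.

Definition sup_affine x : \bar R :=
  ereal_sup [set (d (r i) x + c i)%:E | i in D].

Lemma sup_affine_ub i x : D i -> ((d (r i) x + c i)%:E <= sup_affine x)%E.
Proof. by move=> Di; apply: ereal_sup_ubound; exists i. Qed.

(** One affine piece already exceeds [a] at [x], and Cauchy-Schwarz keeps it above [a] nearby. *)
Lemma sup_affine_lsc : ip_lsc d sup_affine.
Proof.
move=> x a /ereal_sup_gt [_ [i Di <-]]; rewrite lte_fin => ax.
pose s := d (r i) x + c i - a.
have s0 : 0 < s by rewrite /s; lra.
have Nr := ip_ge0 ip (r i).
exists (s ^+ 2 / (d (r i) (r i) + 1)); first by rewrite divr_gt0 ?exprn_gt0 //; lra.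
move=> y; rewrite ltr_pdivlMr; last lra.
have := ip_cauchy_schwarz ip (r i) (y - x); have := ip_ge0 ip (y - x) => Ny CS yx.
apply: lt_le_trans (sup_affine_ub y Di); rewrite lte_fin.
have : `|d (r i) (y - x)| < s.
  rewrite -(@ltr_pXn2r _ 2%N) ?nnegrE ?normr_ge0 ?ltW //= real_normK ?num_real //.
  nra.
rewrite ltr_norml (ipDr ip) (ipNr ip) => /andP[+ _]; rewrite /s; lra.
Qed.

Lemma sup_affine_convex : convex_fun sup_affine.
Proof.
move=> x y t /andP[t0 t1]; apply: ge_ereal_sup => _ [i Di <-].
have -> : d (r i) (t *: x + (1 - t) *: y) + c i
   = t * (d (r i) x + c i) + (1 - t) * (d (r i) y + c i).
  by rewrite !(ipE ip); ring.
rewrite EFinD !EFinM; apply: leeD; apply: lee_wpmul2l; rewrite ?lee_fin ?subr_ge0 //;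
  exact: sup_affine_ub.
Qed.

End SupAffine.

(** * Positive definite operators and maximal monotonicity *)

Section SymPosDef.
Context (R : realType) (H : vectType R) (dot : {dot H for (@idfun R)}).
Implicit Types (A : H -> set H) (Q P : 'End(H)).

Lemma dot_inner_product : inner_product dot.
Proof.
split; first by move=> x y; rewrite hermC /= expr0 mul1r.
- by move=> a x y z; rewrite linearPl.
- exact: neq0_dnorm_gt0.
Qed.

Let dotE := ipE dot_inner_product.
Let dotC := ipC dot_inner_product.

Lemma sym_posdef_ip Q : sym_posdef dot Q -> inner_product (fun x y => dot (Q x) y).
Proof.
move=> [Qsym Qpos]; split=> // [x y|a x y z]; first by rewrite Qsym dotC.
by rewrite linearP !dotE.
Qed.

Lemma sym_posdef_ker Q : sym_posdef dot Q -> lker Q == 0%VS.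
Proof.
move=> hQ; have ip := sym_posdef_ip hQ; apply/lker0P => x y Qxy.
apply/eqP; rewrite -subr_eq0; apply/eqP/(ip_le0_eq0 ip).
have -> : Q (x - y) = 0 by rewrite linearB /= Qxy subrr.
by rewrite (ip0l dot_inner_product).
Qed.

Lemma sym_posdefK Q : sym_posdef dot Q -> cancel Q (Q^-1)%VF.
Proof. by move/sym_posdef_ker/lker0_lfunK. Qed.

Lemma sym_posdefVK Q : sym_posdef dot Q -> cancel (Q^-1)%VF Q.
Proof. by move/sym_posdef_ker/lker0_lfunVK. Qed.

Lemma sym_posdefV Q : sym_posdef dot Q -> sym_posdef dot (Q^-1)%VF.
Proof.
move=> hQ; have QV := sym_posdefVK hQ; have [Qsym Qpos] := hQ; split=> [x y|x x0].
  by rewrite -{1}(QV y) -Qsym QV.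
rewrite -{2}(QV x) -Qsym; apply: Qpos.
by apply: contraNneq x0 => Qx; rewrite -(QV x) Qx linear0.
Qed.

(** Adjoining the pair [(y, u)] to the graph keeps it monotone, so by maximality it was there
    already. *)
Lemma maximally_monotone_related A y u : maximally_monotone dot A ->
  (forall z w, A z w -> 0 <= dot (w - u) (z - y)) -> A y u.
Proof.
move=> [Amono Amax] rel.
pose B x := [set v | A x v \/ x = y /\ v = u].
suff <- : B = A by right.
apply: Amax; last by move=> x v; left.
move=> x1 x2 v1 v2 [Av1|[-> ->]] [Av2|[-> ->]].
- exact: Amono.
- exact: rel.
- by have := rel _ _ Av2; rewrite !dotE; lra.
- by rewrite !subrr (ip0l dot_inner_product).
Qed.

(** Every pair is vacuously related to an empty graph. This makes the Fitzpatrick function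
    proper. *)
Lemma maximally_monotone_nonempty A : maximally_monotone dot A ->
  exists y u, A y u.
Proof.
move=> hA; apply: contrapT => A0; apply: (A0); exists 0, 0.
by apply: maximally_monotone_related => // z w Azw; case: A0; exists z, w.
Qed.

(* The Fitzpatrick function [F(y, u) = sup_{(z, w) in gra A} <z, u> + <y, w> - <z, w>]
   majorizes the duality product and coincides with it on the graph of [A]; the
   solution is read off the minimizer of
   [F(y, u) + |y - x|_Q^2 / 2 + |u - Q x|_{Q^-1}^2 / 2]. *)
Theorem minty A Q : maximally_monotone dot A -> sym_posdef dot Q ->
  forall x, exists y, A y (Q (x - y)).
Proof.
move=> hA hQ x; have [Amono _] := hA; have [Qsym _] := hQ.
set Qi := (Q^-1)%VF.
have QK : cancel Q Qi := sym_posdefK hQ; have QV : cancel Qi Q := sym_posdefVK hQ.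
have ipQ := sym_posdef_ip hQ; have ipQi := sym_posdef_ip (sym_posdefV hQ).
pose V : vectType R := (H * H)%type.
pose d (p q : V) := dot (Q p.1) q.1 + dot (Qi p.2) q.2.
have ipd : inner_product d.
  split=> [p q|a p q s|[y u] yu0]; rewrite /d /=.
  - by rewrite (ipC ipQ) (ipC ipQi).
  - by rewrite (ipDl ipQ) (ipZl ipQ) (ipDl ipQi) (ipZl ipQi); ring.
  - have Ny := ip_ge0 ipQ y; have Nu := ip_ge0 ipQi u.
    rewrite lt_neqAle addr_ge0 // andbT eq_sym; apply: contraNneq yu0 => yu0.
    apply/eqP; congr pair; [apply: (ip_le0_eq0 ipQ)|apply: (ip_le0_eq0 ipQi)]; lra.
pose D := [set p : V | A p.1 p.2].
(* The slope [(Qi w, Q z)] represents the linear form sending [(y, u)] to <z, u> + <y, w> with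
   respect to [d]. *)
pose F := sup_affine d D (fun p => (Qi p.2, Q p.1) : V) (fun p => - dot p.1 p.2).
have affE p q : d (Qi p.2, Q p.1) q - dot p.1 p.2
    = dot p.1 q.2 + dot q.1 p.2 - dot p.1 p.2.
  by rewrite /d /= QV QK (dotC p.2); lra.
have F_graph y u : A y u -> (F (y, u) <= (dot y u)%:E)%E.
  move=> Ayu; apply: ge_ereal_sup => _ [[z w] Azw <-]; rewrite lee_fin affE /=.
  have := Amono _ _ _ _ Ayu Azw.
  by rewrite !dotE (dotC u) (dotC w) (dotC u) (dotC w); lra.
(* If [F (y, u)] were below <y, u>, then <w - u, z - y> > 0 on the whole graph, so [(y, u)] would
   lie in it and its own term in the supremum would be <y, u>. *)
have F_ge y u : ((dot y u)%:E <= F (y, u))%E.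
  rewrite leNgt; apply/negP => Fyu.
  have Ayu : A y u.
    apply: maximally_monotone_related => // z w Azw.
    have := le_lt_trans (sup_affine_ub _ _ _ (y, u) (_ : D (z, w))) Fyu.
    move=> /(_ Azw); rewrite lte_fin affE /= !dotE.
    by rewrite (dotC u) (dotC w) (dotC u) (dotC w); lra.
  have := le_lt_trans (sup_affine_ub _ _ _ (y, u) (_ : D (y, u))) Fyu.
  by move=> /(_ Ayu); rewrite lte_fin affE /=; lra.
have F_proper : proper_fun F.
  split=> [[y u]|]; first by apply: lt_le_trans (F_ge y u); rewrite ltNyr.
  have [y [u Ayu]] := maximally_monotone_nonempty hA.
  by exists (y, u); apply: le_lt_trans (F_graph _ _ Ayu) _; rewrite ltry.
have [[y u] [_ Fyu]] := prox_exists ipd F_proper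
  (sup_affine_lsc ipd) (sup_affine_convex _ _ _ ipd) (x, Q x).
(* The optimality condition at [(y, u)] pairs the variables with [c] and [a]; rearranged, it says <z
   - a, w - c> >= |y - a|_Q^2 on the graph. *)
pose a := x - Qi u; pose c := Q (x - y).
have QB v w : Q (v - w) = Q v - Q w by rewrite linearB.
have QiB v w : Qi (v - w) = Qi v - Qi w by rewrite linearB.
have ua : u - c = Q (y - a) by rewrite /c /a !QB QV !opprB addrCA.
have graph_ge z w : A z w -> dot (y - a) (Q (y - a)) <= dot (z - a) (w - c).
  move=> Azw; rewrite -ua.
  have := le_trans (leeD2r _ (F_ge y u)) (le_trans (Fyu (z, w)) (F_graph _ _ Azw)).
  rewrite -EFinD lee_fin /d /= QiB QK -/c -/a !dotE.
  rewrite (dotC c z) (dotC c y); lra.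
have Aac : A a c.
  apply: maximally_monotone_related => // z w /graph_ge zw.
  by rewrite dotC; apply: le_trans zw; rewrite dotC (ip_ge0 ipQ).
(* Testing the inequality at [(a, c)] itself forces [y = a]. *)
have := graph_ge _ _ Aac; rewrite !subrr (ip0r dot_inner_product) dotC.
move=> /(ip_le0_eq0 ipQ)/eqP; rewrite subr_eq0 => /eqP ya.
by exists y; rewrite {1}ya.
Qed.

End SymPosDef.

(** * The positive square root *)

Lemma poly_interpolation (F : fieldType) (s : seq F) (f : F -> F) :
  uniq s -> exists r : {poly F}, forall a, a \in s -> r.[a] = f a.
Proof.
elim: s => [|a s IH] /=; first by exists 0.
move=> /andP[a_s /IH [r rP]]; pose w := \prod_(b <- s) ('X - b%:P).
have wa : w.[a] != 0 by rewrite -/(root w a) root_prod_XsubC.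
(* Newton's correction: [w] vanishes at the earlier nodes but not at [a]. *)
exists (r + ((f a - r.[a]) / w.[a]) *: w) => b; rewrite !hornerE inE.
case/predU1P => [->|bs]; first by rewrite divfK // addrC subrK.
have /rootP -> : root w b by rewrite root_prod_XsubC.
by rewrite mulr0 addr0 rP.
Qed.

(** Take a complex root a + ib. If b is nonzero, the remainder of [p] modulo the real quadratic with
    that root has degree at most 1 and a non-real root, so it is zero. *)
Lemma rcf_poly_factor (R : rcfType) (p : {poly R}) : (1 < size p)%N ->
  (exists a, root p a) \/
  exists a b, b != 0 /\ ('X - a%:P) ^+ 2 + (b ^+ 2)%:P %| p.
Proof.
move=> p1; pose toC := real_complex R.
have [|[a b] /rootP pz] := closed_rootP (map_poly toC p) _.
  by rewrite size_map_poly gtn_eqF.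
have [b0|b0] := eqVneq b 0.
  by left; exists a; rewrite -(fmorph_root toC); apply/rootP; rewrite -[RHS]pz b0.
right; exists a, b; split=> //; set q := _ + _.
have sq : size q = 3.
  rewrite /q size_polyDl ?size_exp_XsubC // size_polyC; by case: (_ != 0).
have qz : (map_poly toC q).[(a +i* b)%C] = 0.
  rewrite /q rmorphD rmorphXn /= map_polyXsubC map_polyC /= !hornerE.
  by apply/eqP; rewrite eq_complex /=; apply/andP; split; apply/eqP; ring.
rewrite /dvdp; set r := p %% q.
have rz : (map_poly toC r).[(a +i* b)%C] = 0.
  move: pz; rewrite {1}(divp_eq p q) rmorphD rmorphM /= hornerD hornerM qz.
  by rewrite mulr0 add0r.
have sr : (size r <= 2)%N by have := ltn_modp p q; rewrite -size_poly_eq0 sq ltnS.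
have rE : r = r`_1 *: 'X + (r`_0)%:P.
  apply/polyP => i; rewrite !coefE; case: i => [|[|i]] /=;
    rewrite ?mulr0 ?add0r ?mulr1 ?addr0 //.
  by rewrite nth_default // (leq_trans sr).
move: rz; rewrite rE rmorphD /= map_polyZ map_polyX map_polyC /= !hornerE.
move=> /eqP; rewrite eq_complex /= !mul0r subr0 !addr0 => /andP[r0 r1].
move: r1; rewrite mulf_eq0 (negPf b0) orbF => /eqP r1.
by move: r0; rewrite r1 mul0r add0r => /eqP ->; rewrite scale0r addr0.
Qed.

(** * Polynomials in an endomorphism *)

Section PolyAction.
Context (R : realType) (H : vectType R) (Q : 'End(H)).

Definition lfun_pow n : 'End(H) := iter n (comp_lfun Q) \1%VF.

Definition lfun_poly (p : {poly R}) : 'End(H) :=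
  \sum_(i < size p) p`_i *: lfun_pow i.

Lemma lfun_polyE n (p : {poly R}) : (size p <= n)%N ->
  lfun_poly p = \sum_(i < n) p`_i *: lfun_pow i.
Proof.
move=> pn; rewrite /lfun_poly (big_ord_widen n (fun i => p`_i *: lfun_pow i)) //.
rewrite [RHS](bigID (fun i : 'I_n => (i < size p)%N)) /= [X in _ = _ + X]big1 ?addr0 //.
by move=> i; rewrite -leqNgt => ip; rewrite nth_default // scale0r.
Qed.

Lemma lfun_polyD p q : lfun_poly (p + q) = lfun_poly p + lfun_poly q.
Proof.
pose n := maxn (size p) (size q).
rewrite (@lfun_polyE n) ?size_polyD // (@lfun_polyE n p) ?leq_maxl //.
rewrite (@lfun_polyE n q) ?leq_maxr // -big_split; apply: eq_bigr => i _ /=.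
by rewrite coefD scalerDl.
Qed.

Lemma lfun_polyZ c p : lfun_poly (c *: p) = c *: lfun_poly p.
Proof.
rewrite (lfun_polyE (size_scale_leq c p)) scaler_sumr; apply: eq_bigr => i _.
by rewrite coefZ scalerA.
Qed.

Lemma lfun_polyC c : lfun_poly c%:P = c *: \1%VF.
Proof.
by rewrite (@lfun_polyE 1) ?size_polyC_leq1 // big_ord1 coefC.
Qed.

Lemma lfun_polyMX p : lfun_poly (p * 'X) = (Q \o lfun_poly p)%VF.
Proof.
rewrite (@lfun_polyE (size p).+1); last first.
  by rewrite (leq_trans (size_polyMleq _ _)) // size_polyX addn2.
rewrite big_ord_recl coefMX scale0r add0r /lfun_poly.
apply/lfunP => x; rewrite comp_lfunE !sum_lfunE linear_sum; apply: eq_bigr => i _ /=.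
by rewrite coefMX /= !scale_lfunE comp_lfunE linearZ.
Qed.

Lemma lfun_polyX : lfun_poly 'X = Q.
Proof. by rewrite -['X]mul1r lfun_polyMX lfun_polyC scale1r comp_lfun1r. Qed.

Lemma lfun_polyM p q x : lfun_poly (p * q) x = lfun_poly p (lfun_poly q x).
Proof.
elim/poly_ind: p => [|p c IH].
  by rewrite mul0r -[0]/(0%:P) lfun_polyC scale0r !zero_lfunE.
rewrite mulrDl mulrAC mul_polyC !lfun_polyD lfun_polyZ !lfun_polyMX lfun_polyC.
by rewrite !add_lfunE !comp_lfunE IH !scale_lfunE id_lfunE.
Qed.

(** The powers of [Q] taken here outnumber the dimension of ['End(H)] by one, so they are linearly
    dependent. *)
Lemma lfun_poly_annihilator : exists2 p, p != 0 & lfun_poly p = 0.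
Proof.
set N := (\dim (@fullv R 'End(H))).+1.
pose X := [tuple lfun_pow i | i < N].
have : ~~ free X.
  apply/negP => /eqP fX; have := dimvS (subvf <<X>>%VS).
  by rewrite fX size_tuple ltnn.
move=> /freeP nfX; apply: contrapT => np; apply: nfX => k k0 i.
pose p := \poly_(j < N) k (inord j).
apply: contrapT => /eqP ki; apply: np; exists p.
  apply: contra_neq ki => p0; have := congr1 (fun q : {poly R} => q`_i) p0.
  by rewrite coef_poly ltn_ord inord_val coef0.
rewrite (lfun_polyE (size_poly _ _)) -[RHS]k0; apply: eq_bigr => j _.
by rewrite coef_poly ltn_ord inord_val nth_mktuple.
Qed.

End PolyAction.

(** * Annihilating polynomials of a positive definite operator *)

Section SquareRoot.
Context (R : realType) (H : vectType R) (dot : {dot H for (@idfun R)}).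
Variable Q : 'End(H).
Hypothesis hQ : sym_posdef dot Q.

Let ip := dot_inner_product dot.
Local Notation act := (lfun_poly Q).

Lemma lfun_poly_selfadjoint p : selfadjoint dot (act p).
Proof.
have [Qsym _] := hQ; elim/poly_ind: p => [|p c IH] x y.
  by rewrite -[0]/(0%:P) lfun_polyC scale0r !zero_lfunE (ip0l ip) (ip0r ip).
rewrite lfun_polyD lfun_polyMX lfun_polyC !add_lfunE !comp_lfunE !scale_lfunE.
rewrite id_lfunE id_lfunE (ipDl ip) (ipDr ip) (ipZl ip) (ipZr ip); congr (_ + _).
rewrite Qsym IH; congr (dot _ _).
by rewrite -!comp_lfunE -lfun_polyMX comp_lfunE -{2}(lfun_polyX Q) -lfun_polyM mulrC.
Qed.

Lemma act_XsubC a x : act ('X - a%:P) x = Q x - a *: x.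
Proof.
rewrite -scaleN1r lfun_polyD lfun_polyX lfun_polyZ lfun_polyC.
by rewrite add_lfunE !scale_lfunE id_lfunE scaleN1r.
Qed.

(** Here [Q x = a *: x], so <Q x, x> = a |x|^2 is nonpositive. *)
Lemma act_XsubC_nonpos a x : a <= 0 -> act ('X - a%:P) x = 0 -> x = 0.
Proof.
move=> a0; rewrite act_XsubC => /eqP; rewrite subr_eq0 => /eqP Qx.
apply: (ip_le0_eq0 (sym_posdef_ip hQ)); rewrite /= Qx (ipZl ip).
by rewrite mulr_le0_ge0 // ip_ge0.
Qed.

(** For a selfadjoint T, |T x|^2 = <x, T (T x)>. *)
Lemma act_XsubC_sqr a x :
  act ('X - a%:P) (act ('X - a%:P) x) = 0 -> act ('X - a%:P) x = 0.
Proof.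
move=> x0; apply: (ip_le0_eq0 ip).
by rewrite lfun_poly_selfadjoint x0 (ip0r ip).
Qed.

(** Pairing with [x] gives |(Q - a) x|^2 + b^2 |x|^2 = 0. *)
Lemma act_quadratic a b x : b != 0 ->
  act (('X - a%:P) ^+ 2 + (b ^+ 2)%:P) x = 0 -> x = 0.
Proof.
move=> b0 x0; apply: (ip_le0_eq0 ip).
have : dot (act (('X - a%:P) ^+ 2 + (b ^+ 2)%:P) x) x = 0 by rewrite x0 (ip0l ip).
rewrite lfun_polyD lfun_polyC add_lfunE scale_lfunE id_lfunE (ipDl ip) (ipZl ip).
rewrite expr2 lfun_polyM lfun_poly_selfadjoint => xx0.
have := ip_ge0 ip (act ('X - a%:P) x).
have : 0 < b ^+ 2 by rewrite exprn_even_gt0.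
have := ip_ge0 ip x; nra.
Qed.

(* The factors of [p] without positive root are injective at [Q], and repeated
   factors ['X - a] may be dropped because [Q] is selfadjoint. *)
Lemma act_squarefree p : p != 0 -> exists s : seq R,
  [/\ uniq s, forall a, a \in s -> 0 < a
    & forall x, act p x = 0 -> act (\prod_(a <- s) ('X - a%:P)) x = 0].
Proof.
have [n] := ubnP (size p); elim: n p => // n IH p pn p0.
have [p1|/rcf_poly_factor[[a pa]|[a [b [b0 qp]]]]] := leqP (size p) 1.
- exists [::]; split=> // x; rewrite big_nil.
  rewrite (size1_polyC p1) lfun_polyC -[1]/(1%:P) lfun_polyC !scale_lfunE id_lfunE.
  rewrite scale1r => /eqP; rewrite scaler_eq0 => /orP[/eqP pc|/eqP //].
  by rewrite (size1_polyC p1) pc eqxx in p0.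
- have /dvdpP[p' pE] : 'X - a%:P %| p by rewrite dvdp_XsubCl.
  have p'0 : p' != 0 by apply: contraNneq p0 => p'0; rewrite pE p'0 mul0r.
  have [|s [us s0 sP]] := IH p' _ p'0.
    by move: pn; rewrite pE size_Mmonic ?monicXsubC // size_XsubC addn2.
  have sP' x : act p x = 0 -> act (('X - a%:P) * \prod_(b <- s) ('X - b%:P)) x = 0.
    by rewrite mulrC pE !lfun_polyM; apply: sP.
  have [as_|as_] := boolP (a \in s).
    exists s; split=> // x /sP'; rewrite (big_rem a) //= !lfun_polyM.
    exact: act_XsubC_sqr.
  have [a0|a0] := leP a 0.
    exists s; split=> // x /sP'; rewrite lfun_polyM; exact: act_XsubC_nonpos.
  exists (a :: s); split=> [|b|x /sP']; rewrite ?big_cons //= ?as_ //.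
  by rewrite inE => /predU1P[->|/s0].
- have /dvdpP[p' pE] := qp.
  have p'0 : p' != 0 by apply: contraNneq p0 => p'0; rewrite pE p'0 mul0r.
  have qs : size (('X - a%:P) ^+ 2 + (b ^+ 2)%:P) = 3.
    by rewrite size_polyDl ?size_exp_XsubC // size_polyC; case: (_ != 0).
  have [|s [us s0 sP]] := IH p' _ p'0.
    move: pn; rewrite pE size_mul // -?size_poly_eq0 ?qs // addn3 /=.
    by move/ltnW; rewrite ltnS.
  exists s; split=> // x; rewrite pE mulrC lfun_polyM => /(act_quadratic b0).
  exact: sP.
Qed.

(* [r] interpolates the fourth root on the spectrum, so that [r(Q)^2] is
   positive and squares to [Q]. *)
Lemma sqrt_op_exists : exists S, sym_posdef dot S /\ (S \o S)%VF = Q.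
Proof.
have [p p0 pQ] := lfun_poly_annihilator Q.
have [s [us s0 sP]] := act_squarefree p0.
have [r rP] := poly_interpolation (fun a => Num.sqrt (Num.sqrt a)) us.
have r4 x : act (r ^+ 2) (act (r ^+ 2) x) = Q x.
  (* [r ^+ 4 - 'X] vanishes at every point of [s], so it is a multiple of the squarefree product,
     which acts as zero. *)
  have /dvdpP[k kE] : \prod_(a <- s) ('X - a%:P) %| r ^+ 2 * r ^+ 2 - 'X.
    apply: uniq_roots_dvdp; last by rewrite uniq_rootsE.
    apply/allP => a as_; apply/rootP.
    rewrite hornerD hornerN hornerX hornerM horner_exp rP // sqr_sqrtr ?sqrtr_ge0 //.
    by rewrite -expr2 sqr_sqrtr ?subrr // ltW // s0.
  rewrite -lfun_polyM -[r ^+ 2 * _](subrK 'X) kE lfun_polyD lfun_polyX add_lfunE.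
  by rewrite lfun_polyM sP ?linear0 ?add0r // pQ zero_lfunE.
exists (act (r ^+ 2)); split; last by apply/lfunP => x; rewrite comp_lfunE r4.
split=> [|x x0]; first exact: lfun_poly_selfadjoint.
rewrite expr2 lfun_polyM lfun_poly_selfadjoint neq0_dnorm_gt0 //.
(* If [r] evaluated at [Q] killed [x], so would its fourth power [Q]. *)
apply: contraNneq x0 => rx0; apply/eqP/(act_XsubC_nonpos (lexx 0)).
by rewrite act_XsubC scale0r subr0 -r4 !expr2 !lfun_polyM rx0 !linear0.
Qed.

Lemma sqrt_opP :
  sym_posdef dot (sqrt_op dot Q) /\ (sqrt_op dot Q \o sqrt_op dot Q)%VF = Q.
Proof. exact: (@xgetPex _ _ [set S | _ /\ _] sqrt_op_exists). Qed.

End SquareRoot.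

(** * Moreau decompositions *)

Section SetValued.
Context (R : realType) (H : vectType R).
Implicit Types (A B : H -> set H) (f : H -> H).

Lemma resolventP B x y : resolvent B x y <-> B y (x - y).
Proof.
split=> [[_ -> [v Bv <-]]|Bxy]; first by rewrite addrC addKr.
by exists y => //; exists (x - y) => //; rewrite addrC subrK.
Qed.

Lemma sv_comp_svl f B x : (sv f [o] B) x = f @` B x.
Proof. by apply/seteqP; split=> [_ [y By ->]|_ [y By <-]]; exists y. Qed.

Lemma sv_comp_svr B f x : (B [o] sv f) x = B (f x).
Proof. by apply/seteqP; split=> [y [_ -> ?]|y By] //; exists (f x). Qed.

Lemma sv_add_set1 A B x a b :
  A x = [set a] -> B x = [set b] -> (A [+] B) x = [set a + b].
Proof.
rewrite /sv_add => -> ->; apply/seteqP; split=> [_ [_ -> [_ -> <-]]|_ ->] //.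
by exists a => //; exists b.
Qed.

End SetValued.

(** * Subgradients, proximal points and conjugates *)

Section Decomposition.
Context (R : realType) (H : vectType R) (dot : {dot H for (@idfun R)}).
Implicit Types (A : H -> set H) (P Q : 'End(H)) (g h : H -> \bar R).

Let ip := dot_inner_product dot.

Definition subgradient g p u :=
  forall y, (g p + (dot u (y - p))%:E <= g y)%E.

Lemma lsc_fun_ip h Q : lsc_fun dot h -> sym_posdef dot Q ->
  ip_lsc (fun x y => dot (Q x) y) h.
Proof.
move=> h_lsc hQ x a /h_lsc[e e0 He].
have [C C0 HC] := ip_equiv ip (sym_posdef_ip hQ).
exists (e ^+ 2 / C); first by rewrite divr_gt0 ?exprn_gt0.
move=> y; rewrite ltr_pdivlMr // mulrC => yx; apply: He.
rewrite /hnorm -(gtr0_norm e0) -sqrtr_sqr ltr_sqrt ?exprn_gt0 //.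
exact: le_lt_trans (HC _) yx.
Qed.

(** Expanding the quadratic around [p] leaves a margin of |y - p|_P^2 / 2 in the minimality
    inequality; this margin gives uniqueness. *)
Lemma prox_subgradient g P b p : sym_posdef dot P -> g p \is a fin_num ->
  subgradient g p (P (b - p)) -> prox dot P g b = [set p].
Proof.
move=> hP gp sub; have ipP := sym_posdef_ip hP.
have strong y : (g p + (2^-1 * sqnorm dot P (p - b) +
    2^-1 * dot (P (y - p)) (y - p))%:E <= g y + (2^-1 * sqnorm dot P (y - b))%:E)%E.
  apply: le_trans (leeD2r _ (sub y)); rewrite -addeA leeD2l // -EFinD lee_fin.
  rewrite /sqnorm -(opprB p b) linearN (ipNl ip).
  have -> : y - b = (y - p) + (p - b) by rewrite addrA subrK.
  move: (y - p) (p - b) => u v; rewrite !(ipE ipP) (ipC ipP u v); lra.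
apply/seteqP; split=> [x px|_ -> y]; last first.
  apply: le_trans (strong y); rewrite leeD2l // lee_fin lerDl.
  by rewrite mulr_ge0 // (ip_ge0 ipP).
apply/eqP; rewrite -subr_eq0; apply/eqP/(ip_le0_eq0 ipP).
have := le_trans (strong x) (px p); move: gp; case: (g p) => // r _.
rewrite -!EFinD lee_fin /=; lra.
Qed.

(** The subgradient inequality is equality in Young-Fenchel, [conjugate dot h u] = <p, u> - [h p];
    subtracting it from Young-Fenchel at another [v] reverses the roles of [p] and [u]. *)
Lemma conjugate_subgradient h p u : h p \is a fin_num -> subgradient h p u ->
  conjugate dot h u \is a fin_num /\ subgradient (conjugate dot h) u p.
Proof.
move=> hp sub.
have young v : ((dot p v)%:E - h p <= conjugate dot h v)%E.
  by apply: ereal_sup_ubound; exists p.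
have hu : conjugate dot h u = ((dot p u)%:E - h p)%E.
  apply/eqP; rewrite eq_le young andbT; apply: ge_ereal_sup => _ [y _ <-].
  have := sub y; move: hp; case: (h p) => // r _.
  case: (h y) => [s| |] //=; last by rewrite addeNy leNye.
  by rewrite -!EFinD !lee_fin !(ipE ip) (ipC ip y) (ipC ip p); lra.
split; first by rewrite hu fin_numB.
move=> v; apply: le_trans (young v); rewrite hu.
move: hp; case: (h p) => // r _; rewrite -!EFinD lee_fin !(ipE ip); lra.
Qed.

End Decomposition.
Theorem corollary2p5 (R : realType) (H : vectType R)
    (dot : {dot H for (@idfun R)})
    (A : H -> set H) (hA : maximally_monotone dot A)
    (h : H -> \bar R) (h_proper : proper_fun h)
    (h_lsc : lsc_fun dot h) (h_convex : convex_fun h)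
    (Q : 'End(H)) (hQ : sym_posdef dot Q) :
  let Qi := (Q^-1)%VF in
  let Qh := sqrt_op dot Q in
  let Qhi := (Qh^-1)%VF in
  [/\ sv idfun = resolvent (sv Qi [o] A) [+] resolvent (sv_inv A [o] sv Q),
      sv idfun = resolvent (sv Qi [o] A)
                 [+] sv Qi [o] resolvent (sv Q [o] sv_inv A) [o] sv Q
    & sv idfun = sv Qi [o] resolvent (A [o] sv Qi) [o] sv Q
                 [+] resolvent (sv_inv A [o] sv Q) ]
  /\
  [/\ sv idfun = sv Qhi [o] prox dot \1%VF (h \o Qhi) [o] sv Qh
                 [+] sv Qhi [o] prox dot \1%VF (conjugate dot h \o Qh) [o] sv Qh
    & sv idfun = prox dot Q h
                 [+] sv Qi [o] prox dot Qi (conjugate dot h) [o] sv Q ].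
Proof.
move=> Qi Qh Qhi; have ip := dot_inner_product dot; have ipQ := sym_posdef_ip hQ.
have QK : cancel Q Qi := sym_posdefK hQ; have QV : cancel Qi Q := sym_posdefVK hQ.
have QB v w : Q (v - w) = Q v - Q w by rewrite linearB.
have hQi : sym_posdef dot Qi := sym_posdefV hQ.
split.
  suff key x : exists y,
      [/\ resolvent (sv Qi [o] A) x = [set y],
          resolvent (sv_inv A [o] sv Q) x = [set x - y],
          (sv Qi [o] resolvent (sv Q [o] sv_inv A) [o] sv Q) x = [set x - y]
        & (sv Qi [o] resolvent (A [o] sv Qi) [o] sv Q) x = [set y]].
    split; apply/funext => x; have [y [e1 e2 e3 e4]] := key x; apply/esym.
    - by rewrite (sv_add_set1 e1 e2) addrC subrK.
    - by rewrite (sv_add_set1 e1 e3) addrC subrK.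
    - by rewrite (sv_add_set1 e4 e2) addrC subrK.
  have [y Ay] := minty hA hQ x; exists y.
  (* Monotonicity applied to two solutions gives -|z - y|_Q^2 >= 0. *)
  have y_unique z : A z (Q (x - z)) -> z = y.
    move=> Az; apply/eqP; rewrite -subr_eq0; apply/eqP/(ip_le0_eq0 ipQ).
    have := hA.1 _ _ _ _ Az Ay; rewrite -QB.
    have -> : x - z - (x - y) = - (z - y) by rewrite opprB addrC addrA subrK opprB.
    by rewrite linearN (ipNl ip) oppr_ge0.
  split.
  - apply/seteqP; split=> [z /resolventP|_ ->].
      by rewrite sv_comp_svl => -[w Aw /(congr1 Q)]; rewrite QV => wE;
        apply: y_unique; rewrite -wE.
    by apply/resolventP; rewrite sv_comp_svl; exists (Q (x - y)).
  - apply/seteqP; split=> [z /resolventP|_ ->].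
      (* Membership reads [A (x - z) (Q z)], which is Minty's inclusion for [x - z]. *)
      rewrite sv_comp_svr => Az; have <- : x - z = y by apply: y_unique; rewrite subKr.
      by rewrite subKr.
    by apply/resolventP; rewrite sv_comp_svr subKr.
  - rewrite sv_comp_svr sv_comp_svl.
    apply/seteqP; split=> [_ [z /resolventP + <-]|_ ->].
      rewrite sv_comp_svl => -[w Aw Qw].
      (* The witness [w] of the inverse, not [z], is the solution of Minty's inclusion. *)
      have zE : z = Q (x - w) by rewrite QB Qw subKr.
      by rewrite zE QK (y_unique w) // -zE.
    exists (Q (x - y)); last by rewrite QK.
    by apply/resolventP; rewrite sv_comp_svl -QB subKr; exists y.
  - rewrite sv_comp_svr sv_comp_svl.
    apply/seteqP; split=> [_ [z /resolventP + <-]|_ ->].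
      have -> : Q x - z = Q (x - Qi z) by rewrite QB QV.
      by rewrite sv_comp_svr => /y_unique.
    by exists (Q y); [apply/resolventP; rewrite sv_comp_svr QK -QB|rewrite QK].
have [hQh QhQh] := sqrt_opP hQ; rewrite -/Qh in hQh QhQh.
have QhK : cancel Qh Qhi := sym_posdefK hQh.
have QhV : cancel Qhi Qh := sym_posdefVK hQh.
have [Qhsym _] := hQh.
have QE v : Q v = Qh (Qh v) by rewrite -QhQh comp_lfunE.
have QhB v w : Qh (v - w) = Qh v - Qh w by rewrite linearB.
have hI : sym_posdef dot \1%VF.
  split=> [v w|v v0]; rewrite !id_lfunE //; exact: neq0_dnorm_gt0.
have hsub b : exists2 p, h p \is a fin_num & subgradient dot h p (Q (b - p)).
  have [p [Dp psub]] := prox_exists ipQ h_proper (lsc_fun_ip h_lsc hQ) h_convex b.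
  by exists p => //; rewrite (proper_fineK h_proper Dp).
split; apply/funext => b; apply/esym; have [p hp psub] := hsub b;
  have [hu usub] := conjugate_subgradient hp psub; set u := Q (b - p) in psub hu usub.
- have -> : sv idfun b = [set p + (b - p)] by rewrite addrC subrK.
  apply: sv_add_set1; rewrite sv_comp_svr sv_comp_svl.
    (* In the variable [Qh p], the subgradient [u] of [h] becomes [Qh (b - p)], because
       [u = Qh (Qh (b - p))]. *)
    rewrite (@prox_subgradient _ _ _ _ _ _ (Qh p)) //=.
    + by rewrite image_set1 QhK.
    + by rewrite QhK.
    + move=> y /=; rewrite QhK; apply: le_trans (psub (Qhi y)).
      by rewrite leeD2l // lee_fin id_lfunE /u QE Qhsym !QhB QhV.
  (* [Qh] sends this point to [u], where the conjugate has subgradient [p]; the composite then has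
     subgradient [Qh p]. *)
  rewrite (@prox_subgradient _ _ _ _ _ _ (Qh (b - p))) //=.
  + by rewrite image_set1 QhK.
  + by rewrite -QE.
  + move=> y /=; rewrite -QE -/u; apply: le_trans (usub (Qh y)).
    by rewrite leeD2l // lee_fin id_lfunE -QhB subKr Qhsym QhB -QE.
- have -> : sv idfun b = [set p + (b - p)] by rewrite addrC subrK.
  apply: sv_add_set1; first exact: prox_subgradient.
  rewrite sv_comp_svr sv_comp_svl (@prox_subgradient _ _ _ _ _ _ u) //.
    by rewrite image_set1 QK.
  (* For the centre [Q b] and the metric [Qi], the required subgradient is [Qi (Q b - u)], which is
     [p]. *)
  by rewrite /u -QB subKr QK.
Qed.
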